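(* Suppose that Assumptions 1 and 2 hold (see context), and let $(z^k)_{k\in\mathbb{N}}$ be generated by the SPIRAL algorithm described in the context. Suppose moreover that: (A1) $(z^k)_{k\in\mathbb{N}}$ converges to a strong local minimum $z^\star$ of $\varphi$; (A2) the directions $d^k$ are superlinear relative to $(z^k)_{k\in\mathbb{N}}$, i.e. $\lim_{k\to\infty}\frac{\|z^k+d^k-z^\star\|}{\|z^k-z^\star\|}=0$; (A3) the mapping $T$ is strictly differentiable at $\nabla\hat h(z^\star)$. Then, asymptotically (i.e. for all $k$ sufficiently large), the linesearch condition in step 4 of the algorithm is accepted with $\tau_k=1$ (no backtracking), and $(z^k)_{k\in\mathbb{N}}$ converges to $z^\star$ at superlinear rate.
   Context: Problem: minimize over $z\in\mathbb{R}^n$ the function $\varphi(z)=f(z)+g(z)$, with $f=\frac1N\sum_{i=1}^N f_i$. Write $[N]=\{1,\dots,N\}$. A distance-generating function (dgf) is a strictly convex, continuously differentiable function $h:\mathbb{R}^n\to\mathbb{R}$; its Bregman distance is $D_h(y,x)=h(y)-h(x)-\langle\nabla h(x),y-x\rangle$. A function $f:\mathbb{R}^n\to\mathbb{R}$ is $L$-smooth relative to $h$ ($L\ge0$) if $Lh+f$ and $Lh-f$ are convex on $\mathbb{R}^n$. Assumption 1: (a) for each $i\in[N]$, $f_i:\mathbb{R}^n\to\mathbb{R}$ is $L_i$-smooth relative to a dgf $h_i:\mathbb{R}^n\to\mathbb{R}$; (b) $g:\mathbb{R}^n\to\mathbb{R}\cup\{\infty\}$ is proper and lower semicontinuous; (c)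 $\arg\min\varphi\ne\emptyset$. Assumption 2: (a) $g$ is convex; (b) for each $i\in[N]$, $f_i,h_i\in C^2(\mathbb{R}^n)$ with $\nabla^2h_i\succ0$ everywhere. Notation. Fix stepsizes $\gamma_i\in(0,N/L_i)$ (with $N/0=\infty$). Set $\hat h_i=\frac1{\gamma_i}h_i-\frac1N f_i$ and $\hat h=\sum_{i=1}^N\hat h_i$ (these are dgfs). Define the mapping $$T(s)=\arg\min_{w\in\mathbb{R}^n}\Big\{g(w)+\sum_{i=1}^N\tfrac1{\gamma_i}h_i(w)-\langle s,w\rangle\Big\}$$ (at most single-valued when $g$ is convex), and $\mathcal{L}(y,x)=\varphi(y)+D_{\hat h}(y,x)$, evaluated at pairs with $y\in T(\nabla\hat h(x))$. SPIRAL algorithm. Parameters: $z^{\rm init}\in\mathbb{R}^n$, $\beta\in(0,1)$, maximum number of backtracks $q_{\max}\in\mathbb{N}\cup\{\infty\}$. Initialize $s^0=\nabla\hat h(z^{\rm init})$. For $k=0,1,2,\dots$: 1. Choose $z^k\in T(s^k)$. 2. Choose $v^k\in T(\nabla\hat h(z^k))$. 3. Choose a direction $d^k\in\mathbb{R}^n$. 4. (Linesearch) Set $\tau_k=1$, $q_k=0$. Repeat: set $u^k=\tau_kz^k+(1-\tau_k)v^k+\tau_kd^k$ and choose $y^k\in T(\nabla\hat h(u^k))$; if $\mathcal{L}(y^k,u^k)\le\mathcal{L}(v^k,z^k)$, stop (the current $\tau_k$ is accepted); else if $q_k=q_{\max}$, set $u^k=v^k$ and stop; else replace $\tau_k$ by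 $\beta\tau_k$, $q_k$ by $q_k+1$, and repeat. 5. (Incremental loop) Set $s=\nabla\hat h(u^k)$. For $\ell=1,\dots,N$: pick $i^\ell\in[N]$ (at random) without replacement, so that $(i^1,\dots,i^N)$ is a permutation of $[N]$ which may depend on $k$; choose $\tilde z^k_{i^\ell}\in T(s)$; replace $s$ by $s+\nabla\hat h_{i^\ell}(\tilde z^k_{i^\ell})-\nabla\hat h_{i^\ell}(u^k)$. 6. Set $s^{k+1}=s$ (hence $s^{k+1}=\sum_{i=1}^N\nabla\hat h_i(\tilde z_i^k)$). Here an infinite sequence generated by the algorithm is considered. A point $z^\star$ is a strong local minimum of $\varphi$ if there are a neighborhood $\mathcal{N}$ of $z^\star$ and $c>0$ with $\varphi(z)\ge\varphi(z^\star)+\frac c2\|z-z^\star\|^2$ for all $z\in\mathcal{N}$. A mapping $F$ is strictly differentiable at $\bar s$ if there is a linear map $J$ with $\|F(s)-F(s')-J(s-s')\|/\|s-s'\|\to0$ as $s,s'\to\bar s$, $s\ne s'$. A sequence $(x^k)$ converges to $x^\star$ superlinearly if either $x^k=x^\star$ for some $k$ or $\lim_{k\to\infty}\|x^{k+1}-x^\star\|/\|x^k-x^\star\|=0$. *)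

(* Defs.v *)
From HB Require Import structures.
From mathcomp Require Import all_boot all_order all_algebra all_fingroup.
From mathcomp Require Import all_classical all_reals all_analysis.

Set Implicit Arguments.
Unset Strict Implicit.
Unset Printing Implicit Defensive.

Import Order.TTheory GRing.Theory Num.Theory.
Import numFieldNormedType.Exports.

Local Open Scope classical_set_scope.
Local Open Scope ring_scope.

Section Euclidean.
Context {R : realType} {n : nat}.
Local Notation V := 'rV[R]_n.

Definition dot (x y : V) : R := \sum_(i < n) x 0 i * y 0 i.

(* The library norm `|x| on 'rV[R]_n is the sup norm (with the same topology). *)
Definition enorm (x : V) : R := Num.sqrt (dot x x).

Definition grad (h : V -> R) (x : V) : V := \row_j 'D_(delta_mx 0 j) h x.

Definition hess (h : V -> R) (x : V) : 'M[R]_n := 'J (grad h) x.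

Definition C1 (h : V -> R) : Prop :=
  (forall x, differentiable h x) /\ continuous (grad h).

Definition C2 (h : V -> R) : Prop :=
  [/\ forall x, differentiable h x, forall x, differentiable (grad h) x
    & continuous (hess h)].

Definition posdef (A : 'M[R]_n) : Prop :=
  forall v : V, v != 0 -> 0 < dot (v *m A) v.

Definition strictly_convex (h : V -> R) : Prop :=
  forall (x y : V) (t : R), x != y -> 0 < t < 1 ->
    h (t *: x + (1 - t) *: y) < t * h x + (1 - t) * h y.

Definition dgf (h : V -> R) : Prop := strictly_convex h /\ C1 h.

Definition bregman (h : V -> R) (y x : V) : R :=
  h y - h x - dot (grad h x) (y - x).

Definition relatively_smooth (L : R) (h f : V -> R) : Prop :=
  [/\ 0 <= L,
      convex_function [set: V] (fun x => L * h x + f x)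
    & convex_function [set: V] (fun x => L * h x - f x)].

Definition proper_efun (g : V -> \bar R) : Prop :=
  (forall x, g x != -oo%E) /\ (exists x, g x != +oo%E).

(* Meaningful for g that never takes the value -oo; recall 0 * +oo = 0. *)
Definition econvex (g : V -> \bar R) : Prop :=
  forall (x y : V) (t : R), 0 <= t <= 1 ->
    (g (t *: x + (1 - t) *: y)%R <= t%:E * g x + (1 - t)%:E * g y)%E.

Definition argmin (F : V -> \bar R) : set V :=
  [set w | forall w', (F w <= F w')%E].

Definition strong_local_min (F : V -> \bar R) (xs : V) : Prop :=
  exists2 c : R, 0 < c &
    \forall x \near xs, (F xs + (c / 2 * enorm (x - xs) ^+ 2)%:E <= F x)%E.

Definition strictly_differentiable (F : V -> V) (sb : V) : Prop :=
  exists J : {linear V -> V},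
    (fun p : V * V =>
       enorm (F p.1 - F p.2 - J (p.1 - p.2)) / enorm (p.1 - p.2))
      @ within [set p : V * V | p.1 != p.2] (nbhs (sb, sb)) --> (0 : R).

(* A set-valued mapping is strictly differentiable at sb when it is
   single-valued around sb and the resulting function is. *)
Definition set_strictly_differentiable (T : V -> set V) (sb : V) : Prop :=
  exists F : V -> V, (\forall s \near sb, T s = [set F s]) /\
                     strictly_differentiable F sb.

Definition superlinear_cvg (x : nat -> V) (xs : V) : Prop :=
  (exists k, x k = xs) \/
  (fun k => enorm (x k.+1 - xs) / enorm (x k - xs)) @ \oo --> (0 : R).

(* The quotient is 0/0 or c/0 when z k = zs, and the library's value a / 0 = 0
   would leave d k unconstrained there; the first clause reads the condition at
   those k as |z k + d k - zs| = o(|z k - zs|), that is, d k = 0. *)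
Definition superlinear_directions (z d : nat -> V) (zs : V) : Prop :=
  (\forall k \near \oo, z k = zs -> d k = 0) /\
  (fun k => enorm (z k + d k - zs) / enorm (z k - zs)) @ \oo --> (0 : R).

End Euclidean.

Record problem (R : realType) (n N : nat) := Problem {
  f_ : 'I_N -> 'rV[R]_n -> R;
  h_ : 'I_N -> 'rV[R]_n -> R;
  L_ : 'I_N -> R;
  g_ : 'rV[R]_n -> \bar R;
  gamma_ : 'I_N -> R }.

Section Spiral.
Context {R : realType} {n N : nat}.
Local Notation V := 'rV[R]_n.
Variable P : problem R n N.

Definition favg (x : V) : R := N%:R^-1 * \sum_(i < N) f_ P i x.

Definition phi (x : V) : \bar R := ((favg x)%:E + g_ P x)%E.

Definition assumption1 : Prop :=
  [/\ forall i, dgf (h_ P i) /\ relatively_smooth (L_ P i) (h_ P i) (f_ P i),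
      proper_efun (g_ P) /\ lower_semicontinuous (g_ P)
    & argmin phi !=set0].

Definition assumption2 : Prop :=
  econvex (g_ P) /\
  forall i, [/\ C2 (f_ P i), C2 (h_ P i) & forall x, posdef (hess (h_ P i) x)].

(* gamma_i \in (0, N / L_i), where N / 0 = oo. *)
Definition stepsizes : Prop :=
  forall i, 0 < gamma_ P i /\ (L_ P i != 0 -> gamma_ P i < N%:R / L_ P i).

Definition hhat_ (i : 'I_N) (x : V) : R :=
  (gamma_ P i)^-1 * h_ P i x - N%:R^-1 * f_ P i x.

Definition hhat (x : V) : R := \sum_(i < N) hhat_ i x.

Definition Tmap (s : V) : set V :=
  argmin (fun w =>
    (g_ P w + (\sum_(i < N) (gamma_ P i)^-1 * h_ P i w - dot s w)%:E)%E).

Definition Lyap (y x : V) : \bar R := (phi y + (bregman hhat y x)%:E)%E.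

Record ls_result := LsResult {
  ls_u : V;              (* the point u^k passed to the incremental loop *)
  ls_tau : R;            (* the last stepsize tested *)
  ls_q : nat;            (* the number of backtracks *)
  ls_accepted : bool }.  (* false when u^k = v^k because q_max was reached *)

(* [linesearch beta qmax z v d tau q r]: the loop entered with the current
   values (tau, q) terminates with result r; qmax = None stands for oo. *)
Inductive linesearch (beta : R) (qmax : option nat) (z v d : V) :
    R -> nat -> ls_result -> Prop :=
| Ls_accept tau q (u := tau *: z + (1 - tau) *: v + tau *: d) y :
    Tmap (grad hhat u) y -> (Lyap y u <= Lyap v z)%E ->
    linesearch beta qmax z v d tau q (LsResult u tau q true)
| Ls_give_up tau q (u := tau *: z + (1 - tau) *: v + tau *: d) y :
    Tmap (grad hhat u) y -> ~ (Lyap y u <= Lyap v z)%E ->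
    qmax = Some q ->
    linesearch beta qmax z v d tau q (LsResult v tau q false)
| Ls_backtrack tau q (u := tau *: z + (1 - tau) *: v + tau *: d) y r :
    Tmap (grad hhat u) y -> ~ (Lyap y u <= Lyap v z)%E ->
    qmax <> Some q ->
    linesearch beta qmax z v d (beta * tau) q.+1 r ->
    linesearch beta qmax z v d tau q r.

(* [incremental_loop u s']: some run of the incremental loop from u ends with
   s'. Here i l is the index picked at pass l, zt j is ztilde_j, and sl l is
   the value of s after l passes. *)
Definition incremental_loop (u s' : V) : Prop :=
  exists (i : {perm 'I_N}) (zt : 'I_N -> V) (sl : nat -> V),
    [/\ sl 0%N = grad hhat u,
        forall l : 'I_N, Tmap (sl l) (zt (i l)),
        forall l : 'I_N, sl l.+1 =
          sl l + grad (hhat_ (i l)) (zt (i l)) - grad (hhat_ (i l)) u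
      & s' = sl N].

Definition spiral (zinit : V) (beta : R) (qmax : option nat)
    (s z v d : nat -> V) (ls : nat -> ls_result) : Prop :=
  s 0%N = grad hhat zinit /\
  forall k, [/\ Tmap (s k) (z k),
                Tmap (grad hhat (z k)) (v k),
                linesearch beta qmax (z k) (v k) (d k) 1 0 (ls k)
              & incremental_loop (ls_u (ls k)) (s k.+1)].

End Spiral.

(* Main.v *)
Require Import Defs.
From mathcomp Require Import all_boot all_order all_algebra all_fingroup.
From mathcomp Require Import all_classical all_reals all_analysis.
From mathcomp Require Import ring lra.

Set Implicit Arguments.
Unset Strict Implicit.
Unset Printing Implicit Defensive.

Import Order.TTheory GRing.Theory Num.Theory.
Import numFieldNormedType.Exports.

Local Open Scope classical_set_scope.
Local Open Scope ring_scope.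

(* Put H = hhat and s* = grad H zs.  For y in T(grad H u), Lyap y u is the value
   at u of the Bregman envelope min_w (phi w + D_H(w, u)).  This envelope is at
   most phi zs + D_H(zs, u) <= phi zs + K |u - zs|^2, while at z, with minimizer
   v close to zs, it is phi v + D_H(v, z) >= phi zs + c/2 |v - zs|^2 + D_H(v, z)
   >= phi zs + m |z - zs|^2 with m > 0.  Hence u = z + d with
   |u - zs| = o(|z - zs|) passes the linesearch test at tau = 1.

   By convexity of g + H + f the local minimum satisfies T s* = {zs}, and strict
   differentiability makes T calm at s*: |w - zs| <= C |s - s*| for w in T(s).
   Following the N steps of the incremental loop this gives
   |z^{k+1} - zs| <= C' |u^k - zs| = o(|z^k - zs|).

   All local estimates need only differentiability of the gradients at zs. *)

(** * Inner product, and comparison of the Euclidean norm with the sup norm *)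

Section Dot.
Context {R : realType} {n : nat}.
Implicit Types (x y z : 'rV[R]_n) (a : R).

Lemma dotC x y : dot x y = dot y x.
Proof. by apply: eq_bigr => i _; rewrite mulrC. Qed.

Lemma dotDl x y z : dot (x + y) z = dot x z + dot y z.
Proof. by rewrite -big_split; apply: eq_bigr => i _; rewrite mxE mulrDl. Qed.

Lemma dotZl a x y : dot (a *: x) y = a * dot x y.
Proof. by rewrite mulr_sumr; apply: eq_bigr => i _; rewrite mxE mulrA. Qed.

Lemma dotNl x y : dot (- x) y = - dot x y.
Proof. by rewrite -scaleN1r dotZl mulN1r. Qed.

Lemma dotBl x y z : dot (x - y) z = dot x z - dot y z.
Proof. by rewrite dotDl dotNl. Qed.

Lemma dotDr x y z : dot x (y + z) = dot x y + dot x z.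
Proof. by rewrite !(dotC x) dotDl. Qed.

Lemma dotZr a x y : dot x (a *: y) = a * dot x y.
Proof. by rewrite !(dotC x) dotZl. Qed.

Lemma dotNr x y : dot x (- y) = - dot x y.
Proof. by rewrite !(dotC x) dotNl. Qed.

Lemma dotBr x y z : dot x (y - z) = dot x y - dot x z.
Proof. by rewrite dotDr dotNr. Qed.

Lemma dot0l x : dot 0 x = 0.
Proof. by rewrite -(scale0r 0) dotZl mul0r. Qed.

Lemma dot_suml m (F : 'I_m -> 'rV[R]_n) y :
  dot (\sum_(i < m) F i) y = \sum_(i < m) dot (F i) y.
Proof.
elim/big_rec2 : _ => [|i a b _ <-]; first by rewrite dot0l.
by rewrite dotDl.
Qed.

Lemma coord_le_norm x i : `|x 0 i| <= `|x|.
Proof.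
rewrite [leRHS]mx_normrE.
exact: (le_bigmax _ (fun ij : 'I_1 * 'I_n => `|x ij.1 ij.2|) (0, i)).
Qed.

Lemma norm_dot_le x y : `|dot x y| <= n%:R * (`|x| * `|y|).
Proof.
apply: (le_trans (ler_norm_sum _ _ _)).
rewrite mulr_natl -[X in _ *+ X]card_ord -sumr_const.
apply: ler_sum => i _; rewrite normrM.
by apply: ler_pM => //; apply: coord_le_norm.
Qed.

Lemma enorm_ge x : `|x| <= enorm x.
Proof.
rewrite [leLHS]mx_normrE; apply: bigmax_le => [|[i j] _].
  exact: sqrtr_ge0.
rewrite ord1 /= -sqrtr_sqr; apply: ler_wsqrtr.
rewrite /dot (bigD1 j)//= -expr2 lerDl; apply: sumr_ge0 => k _.
by rewrite -expr2 sqr_ge0.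
Qed.

(** The sharp factor is the square root of n; [n.+1] is simpler and stays positive for n = 0, so it
    can serve as a divisor. *)
Lemma enorm_le x : enorm x <= n.+1%:R * `|x|.
Proof.
have h0 : 0 <= n.+1%:R * `|x| by rewrite mulr_ge0.
rewrite -[leRHS]ger0_norm// -sqrtr_sqr; apply: ler_wsqrtr.
apply: (le_trans (ler_norm _)); apply: (le_trans (norm_dot_le _ _)).
rewrite -expr2 exprMn; apply: ler_wpM2r; first exact: sqr_ge0.
by rewrite -natrX ler_nat expnS expn1 (leq_trans (leqnSn n))// leq_pmulr.
Qed.

Lemma enorm_eq0 x : (enorm x == 0) = (x == 0).
Proof.
apply/eqP/eqP => [x0|->]; last by rewrite /enorm dot0l sqrtr0.
by apply/eqP; rewrite -normr_le0 -x0 enorm_ge.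
Qed.

End Dot.

(** * Gradients, first-order expansions and convexity *)

Section FirstOrder.
Context {R : realType}.

Lemma small_step (r d : R) : 0 <= r -> 0 < d ->
  exists2 t, 0 < t < 1 & t * r < d.
Proof.
(* The [+ 1] keeps the denominator positive when [r] is 0. *)
move=> r0 d0; exists (Num.min (1 / 2) (d / (2 * (r + 1)))).
  apply/andP; split; last by rewrite gt_min; apply/orP; left; lra.
  by rewrite lt_min divr_gt0//= ?divr_gt0//; lra.
set t := Num.min _ _; have t0 : 0 <= t.
  by rewrite le_min !divr_ge0//; lra.
have : t <= d / (2 * (r + 1)) by rewrite ge_min lexx orbT.
by rewrite ler_pdivlMr; nra.
Qed.

Lemma diff_near (V W : normedModType R) (f : V -> W) x :
  differentiable f x -> forall e, 0 < e -> exists2 d, 0 < d &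
  forall y, `|y - x| < d -> `|f y - f x - 'd f x (y - x)| <= e * `|y - x|.
Proof.
move=> /diff_locally fx e e0.
have /eqaddoP/(_ e e0) := fx.
move=> /nbhs_ballP[d /= d0 dP]; exists d => // y xyd.
have /dP : ball 0 d (y - x) by rewrite -ball_normE /ball_/= sub0r normrN.
by rewrite /= !fctE /= subrK /cst opprD addrA.
Qed.

Context {n : nat}.
Local Notation V := 'rV[R]_n.
Implicit Types (h : V -> R) (x y : V).

Lemma diff_grad h x v : differentiable h x -> 'd h x v = dot (grad h x) v.
Proof.
move=> hx; rewrite [in LHS](row_sum_delta v) linear_sum/=.
by apply: eq_bigr => j _; rewrite linearZ/= mxE deriveE// mulrC.
Qed.

Lemma gradD h k x : differentiable h x -> differentiable k x ->
  grad (h + k) x = grad h x + grad k x.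
Proof.
move=> hx kx; apply/rowP => j; rewrite !mxE deriveD//; exact: diff_derivable.
Qed.

Lemma gradZ a h x : differentiable h x -> grad (a *: h) x = a *: grad h x.
Proof.
move=> hx; apply/rowP => j; rewrite !mxE deriveZ//; exact: diff_derivable.
Qed.

Lemma grad_sum m (h : 'I_m -> V -> R) x :
  (forall i, differentiable (h i) x) ->
  grad (\sum_(i < m) h i) x = \sum_(i < m) grad (h i) x.
Proof.
move=> hx; apply/rowP => j; rewrite summxE mxE derive_sum; last first.
  by move=> i; exact: diff_derivable.
by apply: eq_bigr => i _; rewrite mxE.
Qed.

Definition convexR h := forall x y t, 0 < t < 1 ->
  h (t *: x + (1 - t) *: y) <= t * h x + (1 - t) * h y.

Lemma convexR_convex_function h : convex_function [set: V] h -> convexR h.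
Proof.
move=> ch x y t /andP[t0 t1].
exact: (ch (Itv01 (ltW t0) (ltW t1)) x y (mem_set I) (mem_set I)).
Qed.

(** If the gap B at y were negative, convexity would push h below its tangent by at least t |B| at x
    + t (y - x), whereas differentiability allows a deviation of at most e t r, with e r < |B|. *)
Lemma bregman_ge0 h x y : convexR h -> differentiable h x ->
  0 <= bregman h y x.
Proof.
move=> ch hx; rewrite /bregman -diff_grad//.
rewrite leNgt; apply/negP; set B := (X in X < 0) => B0.
set r := `|y - x|; have r0 : 0 <= r by exact: normr_ge0.
pose e := - B / (2 * (r + 1)).
have e0 : 0 < e by rewrite divr_gt0//; lra.
have er : e * r < - B.
  rewrite /e mulrAC ltr_pdivrMr; last lra.
  by nra.
have [d d0 dP] := diff_near hx e0.
have [t /andP[t0 t1] tr] := small_step r0 d0.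
have E : t *: y + (1 - t) *: x = x + t *: (y - x).
  by rewrite scalerBl scale1r scalerBr addrCA addrA.
have := dP (x + t *: (y - x)).
have -> : x + t *: (y - x) - x = t *: (y - x) by rewrite addrC addKr.
rewrite normrZ (gtr0_norm t0) => /(_ tr).
rewrite linearZ/= ler_norml => /andP[le1 _].
have := ch y x t; rewrite t0 t1 E => /(_ isT).
move: le1 er; rewrite -/r /B /GRing.scale/=.
set D := 'd h x _; set u := h (_ + _).
by nra.
Qed.

End FirstOrder.

(** * Calmness of gradients and quadratic bounds on Bregman distances *)

Section SecondOrder.
Context {R : realType}.

(** One endpoint stays at [x], unlike in a local Lipschitz condition, so that differentiability at
    [x] alone yields it. *)
Definition calm {V W : normedModType R} (f : V -> W) (x : V) :=
  exists C d : R, [/\ 0 < C, 0 < d &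
    forall y, `|y - x| < d -> `|f y - f x| <= C * `|y - x|].

Lemma calm_diff (V W : normedModType R) (f : V -> W) x :
  differentiable f x -> calm f x.
Proof.
move=> fx; have [d d0 dP] := diff_near fx ltr01.
have [k k0 kP] := linear_lipschitz (diff_continuous fx).
exists (k + 1), d; split => //; first lra.
move=> y /dP H.
have -> : f y - f x = 'd f x (y - x) + (f y - f x - 'd f x (y - x)).
  by rewrite [RHS]addrC subrK.
by rewrite mulrDl (le_trans (ler_normD _ _))// lerD.
Qed.

Context {n : nat}.
Local Notation V := 'rV[R]_n.
Implicit Types (h : V -> R) (x y : V).

(** The quadratic form attains a positive minimum on the sup-norm unit sphere, which is compact;
    homogeneity extends the bound to all vectors. *)
Lemma posdef_coercive (A : 'M[R]_n) : posdef A ->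
  exists2 mu, 0 < mu & forall v, mu * `|v| ^+ 2 <= dot (v *m A) v.
Proof.
move=> pA; pose S := [set v : V | `|v| = 1].
have scal v : v != 0 -> S (`|v|^-1 *: v).
  by move=> v0; rewrite /S/= normrZ normfV normr_id mulVf// normr_eq0.
(* The sphere is empty only when n = 0, and then any constant works. *)
have [S0|S0] := pselect (S !=set0); last first.
  exists 1 => // v; have [->|v0] := eqVneq v 0.
    by rewrite normr0 expr0n mulr0 mul0mx dot0l.
  by exfalso; apply: S0; exists (`|v|^-1 *: v); exact: scal.
have cS : compact S.
  apply: bounded_closed_compact.
    exists 1; split => // M M1 v vS /=; rewrite (vS : `|v| = 1); exact: ltW.
  apply: (@preimage_closed _ _ (Num.norm : V -> R) [set 1]) => [v _|].
    exact: norm_continuous.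
  exact: closed_eq.
have addc : continuous (fun x : R * R => x.1 + x.2) by exact: add_continuous.
have cl i : continuous (fun v : V => (v *m A) 0 i).
  have -> : (fun v : V => (v *m A) 0 i) =
      (fun v : V => \sum_(j < n) v 0 j * A j i).
    by apply/funext => w; rewrite mxE.
  apply: (continuous_big addc) => j _ w.
  exact: (cvgM (@coord_continuous _ _ _ 0 j w) (cvg_cst (A j i))).
have cA : continuous (fun v : V => dot (v *m A) v).
  rewrite /dot; apply: (continuous_big addc) => i _ v.
  exact: (cvgM (cl i v) (@coord_continuous _ _ _ 0 i v)).
have [c cS1 cmin] := EVT_min_rV S0 cS (continuous_subspaceT cA).
exists (dot (c *m A) c).
  apply: pA; rewrite -normr_eq0; have -> : `|c| = 1 by exact: set_mem.
  exact: oner_neq0.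
move=> v; have [->|v0] := eqVneq v 0.
  by rewrite normr0 expr0n mulr0 mul0mx dot0l.
have := cmin _ (mem_set (scal v v0)).
rewrite -scalemxAl dotZl dotZr mulrA -expr2 exprVn [leRHS]mulrC.
by rewrite ler_pdivlMr// exprn_gt0// normr_gt0.
Qed.

Lemma bregman_three_points h v x z : bregman h v z =
  bregman h x z + bregman h v x + dot (grad h x - grad h z) (v - x).
Proof.
rewrite /bregman dotBl.
have -> : v - z = (v - x) + (x - z) by rewrite addrA subrK.
rewrite (dotDr (grad h z)).
by ring.
Qed.

Lemma bregman_sym h x z :
  bregman h x z + bregman h z x = dot (grad h x - grad h z) (x - z).
Proof. by rewrite /bregman -(opprB x z) dotNr dotBl; ring. Qed.

Lemma bregman_upper h x : convexR h -> (forall y, differentiable h y) ->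
  calm (grad h) x -> exists K d, [/\ 0 < K, 0 < d &
    forall z, `|z - x| < d -> bregman h x z <= K * `|z - x| ^+ 2].
Proof.
move=> ch dh [C [d [C0 d0 dP]]].
exists (n%:R * C + 1), d; split => //.
  by rewrite ltr_wpDl// mulr_ge0// ltW.
move=> z zx.
have H1 := bregman_sym h x z; have H2 := bregman_ge0 z ch (dh x).
have H3 : bregman h x z <= dot (grad h x - grad h z) (x - z).
  by rewrite -H1 lerDl bregman_ge0.
apply: (le_trans H3); apply: (le_trans (ler_norm _)).
apply: (le_trans (norm_dot_le _ _)).
rewrite ![`|_ - z|]distrC [`|_ - grad h z|]distrC mulrDl -mulrA mul1r.
apply: ler_wpDr; first exact: sqr_ge0.
by rewrite ler_wpM2l// expr2 mulrA ler_wpM2r// dP.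
Qed.

(* With m the midpoint of x and z, the three-point identity bounds D(x, z) below
   by <grad h m - grad h z, x - m>, so a first-order expansion of grad h at x
   suffices. *)
Lemma bregman_lower h x : convexR h -> (forall y, differentiable h y) ->
  differentiable (grad h) x -> posdef (hess h x) ->
  exists mu d, [/\ 0 < mu, 0 < d &
    forall z, `|z - x| < d -> mu * `|z - x| ^+ 2 <= bregman h x z].
Proof.
move=> ch dh dg /posdef_coercive[mu mu0 muP].
(* The Hessian term contributes at least mu/4 |w|^2. With this e the two remainders cost at most 3
   mu/32 |w|^2, which leaves more than the claimed mu/8. *)
pose e := mu / (8 * n.+1%:R).
have e0 : 0 < e by rewrite divr_gt0// mulr_gt0.
have [d d0 dP] := diff_near dg e0.
exists (mu / 8), d; split => //; first by rewrite divr_gt0.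
move=> z zx; set w := z - x.
pose m := x + 2^-1 *: w.
have mx : m - x = 2^-1 *: w by rewrite /m addrC addKr.
have mxd : `|m - x| = 2^-1 * `|w| by rewrite mx normrZ ger0_norm.
have mxd' : `|m - x| < d by rewrite mxd; have := normr_ge0 w; lra.
rewrite (bregman_three_points h x m z).
have H1 := bregman_ge0 x ch (dh m); have H2 := bregman_ge0 m ch (dh z).
pose rz := grad h z - grad h x - 'd (grad h) x w.
pose rm := grad h m - grad h x - 'd (grad h) x (m - x).
have rzP : `|rz| <= e * `|w| by exact: dP.
have rmP : `|rm| <= e * (2^-1 * `|w|) by rewrite -mxd; exact: dP.
have E : grad h m - grad h z = - (2^-1 *: 'd (grad h) x w + (rz - rm)).
  rewrite /rz /rm mx linearZ/=.
  move: (grad h m) (grad h z) (grad h x) => a b c.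
  apply/rowP => i; rewrite !mxE; by field.
rewrite E -(opprB m x) mx dotNl dotNr opprK dotZr dotDl dotZl.
have -> : 'd (grad h) x w = w *m hess h x.
  by rewrite /hess /jacobian mul_rV_lin1.
have Hmu := muP w.
have Hn : n%:R * (`|rz - rm| * `|w|) <= 3 / 2 * (mu / 8) * `|w| ^+ 2.
  have H : `|rz - rm| <= 3 / 2 * e * `|w|.
    rewrite (le_trans (ler_normB _ _))//.
    by move: rzP rmP; lra.
  have He : n%:R * e <= mu / 8.
    rewrite /e mulrA ler_pdivrMr ?mulr_gt0// -[n.+1%:R]natr1.
    by move: (n%:R : R) => r; lra.
  rewrite expr2 !mulrA ler_wpM2r//.
  apply: (le_trans (ler_wpM2l _ H)) => //.
  have := ler_wpM2r (normr_ge0 w) He.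
  by move: (n%:R * e) (n%:R : R) => *; lra.
have Hd := norm_dot_le (rz - rm) w.
have := ler_norm (- dot (rz - rm) w); rewrite normrN.
move: Hmu Hn Hd H1 H2; set a := dot (w *m _) w; set b := dot (rz - rm) w.
have : 0 <= mu * `|w| ^+ 2 by rewrite mulr_ge0 ?sqr_ge0// ltW.
by lra.
Qed.

End SecondOrder.

(** * Convexity and Bregman distances of linear combinations *)

Section ConvexBregman.
Context {R : realType} {n : nat}.
Local Notation V := 'rV[R]_n.
Implicit Types (h k : V -> R) (x y : V) (a : R).

Lemma convexRD h k : convexR h -> convexR k -> convexR (h + k).
Proof.
move=> ch ck x y t t01; apply: le_trans (lerD (ch x y t t01) (ck x y t t01)) _.
by rewrite !fctE !mulrDr addrACA.
Qed.

Lemma convexRZ a h : 0 <= a -> convexR h -> convexR (a *: h).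
Proof.
move=> a0 ch x y t t01; rewrite !fctE.
apply: le_trans (ler_wpM2l a0 (ch x y t t01)) _.
by rewrite /GRing.scale/= mulrDr !(mulrCA a).
Qed.

Lemma convexR_sum m (h : 'I_m -> V -> R) :
  (forall i, convexR (h i)) -> convexR (\sum_(i < m) h i).
Proof.
move=> ch; apply: (big_ind convexR) => //; last exact: convexRD.
move=> x y t _; rewrite -[leLHS]/(0 : R).
by rewrite -[leRHS]/(t * 0 + (1 - t) * 0 : R) !mulr0 addr0.
Qed.

Lemma convexR_strict h : strictly_convex h -> convexR h.
Proof.
move=> sh x y t t01; have [->|xy] := eqVneq x y.
  by rewrite -scalerDl -mulrDl addrC subrK scale1r mul1r.
by rewrite ltW// sh.
Qed.

Lemma bregmanD h k y x : differentiable h x -> differentiable k x ->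
  bregman (h + k) y x = bregman h y x + bregman k y x.
Proof. by move=> hx kx; rewrite /bregman gradD// dotDl !fctE; ring. Qed.

Lemma bregmanZ a h y x : differentiable h x ->
  bregman (a *: h) y x = a * bregman h y x.
Proof.
by move=> hx; rewrite /bregman gradZ// dotZl /= /GRing.scale/= !mulrBr.
Qed.

Lemma bregman_sum m (h : 'I_m -> V -> R) y x :
  (forall i, differentiable (h i) x) ->
  bregman (\sum_(i < m) h i) y x = \sum_(i < m) bregman (h i) y x.
Proof.
by move=> hx; rewrite /bregman grad_sum// dot_suml !fct_sumE !sumrB.
Qed.

End ConvexBregman.

(** * Local inequalities drawn from the hypotheses at the limit point *)

Section LocalBounds.
Context {R : realType} {n : nat}.
Local Notation V := 'rV[R]_n.
Implicit Types x : V.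

(** With the second argument of the strict difference quotient fixed at [s], the error against J is
    eventually below the Euclidean distance to [s], and J is bounded. *)
Lemma strictly_differentiable_calm (F : V -> V) s :
  strictly_differentiable F s -> calm F s.
Proof.
move=> [J HJ].
(* J is given only as a linear map; its bound is read off the images of the basis vectors. *)
have [k k0 Jk] : exists2 k, 0 < k & forall v, `|J v| <= k * `|v|.
  exists (1 + \sum_(j < n) `|J (delta_mx 0 j)|).
    by rewrite ltr_pwDl// sumr_ge0.
  move=> v; rewrite [in leLHS](row_sum_delta v) linear_sum/=.
  apply: (le_trans (ler_norm_sum _ _ _)).
  rewrite mulrDl mul1r mulr_suml ler_wpDl//; apply: ler_sum => j _.
  by rewrite linearZ/= normrZ mulrC ler_wpM2l// coord_le_norm.
have /HJ H1 : nbhs (0 : R) (ball 0 1) by exact: nbhsx_ballx.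
have {H1}/nbhs_ballP[d /= d0 dP] : nbhs (s, s) [set p : V * V | p.1 != p.2 ->
    ball (0 : R) 1 (enorm (F p.1 - F p.2 - J (p.1 - p.2)) / enorm (p.1 - p.2))].
  exact: H1.
exists (n.+1%:R + k), d; split => //; first by rewrite ltr_wpDl.
move=> y ys; have [->|yns] := eqVneq y s.
  by rewrite !subrr !normr0 mulr0.
have /dP/= : ball (s, s) d (y, s).
  by split => /=; [rewrite -ball_normE /ball_/= distrC|exact: ballxx].
move=> /(_ yns); rewrite -ball_normE /ball_/= sub0r normrN normrM normfV.
have e0 : 0 < enorm (y - s).
  by rewrite lt_def enorm_eq0 subr_eq0 yns sqrtr_ge0.
rewrite [X in _ / X]gtr0_norm// ltr_pdivrMr// mul1r => H.
rewrite -(subrK (J (y - s)) (F y - F s)) mulrDl.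
apply: (le_trans (ler_normD _ _)); apply: lerD => //.
apply: (le_trans (enorm_ge _)); apply: (le_trans (ler_norm _)).
exact: le_trans (ltW H) (enorm_le _).
Qed.

Lemma strong_local_min_le (F : V -> \bar R) x : strong_local_min F x ->
  \forall w \near x, (F x <= F w)%E.
Proof.
move=> [c c0]; apply: filterS => w; apply: le_trans.
by rewrite leeDl// lee_fin mulr_ge0 ?sqr_ge0// divr_ge0// ltW.
Qed.

(** A division-free form in the sup norm, valid also at those k where [z k = x]. The tolerance
    [e / n.+1] used in the proof absorbs the change of norm. *)
Lemma superlinear_directions_le (z d : nat -> V) x (e : R) :
    superlinear_directions z d x -> 0 < e ->
  \forall k \near \oo, `|z k + d k - x| <= e * `|z k - x|.
Proof.
move=> [zd /cvgrPdist_lt H] e0.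
have e'0 : 0 < e / n.+1%:R by rewrite divr_gt0.
near=> k; have [zx|zx] := eqVneq (z k) x.
  by rewrite (near zd k)// zx addr0 subrr normr0 mulr0.
have : `|0 - enorm (z k + d k - x) / enorm (z k - x)| < e / n.+1%:R.
  by near: k; exact: H.
have p0 : 0 < enorm (z k - x).
  by rewrite lt_def enorm_eq0 subr_eq0 zx sqrtr_ge0.
rewrite sub0r normrN => /(le_lt_trans (ler_norm _)).
rewrite ltr_pdivrMr// => /ltW H1.
apply: (le_trans (enorm_ge _)); apply: (le_trans H1).
by rewrite -mulrA ler_wpM2l ?(ltW e0)// ler_pdivrMl// enorm_le.
Unshelve. all: by end_near. Qed.

(* The cross term K a b is absorbed by mu b^2 / 2 unless a >= mu b / (2 K), and
   then c a^2 alone dominates b^2. *)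
Lemma quadratic_growth (mu c K : R) : 0 < mu -> 0 < c -> 0 < K ->
  exists2 m, 0 < m & forall a b D : R, 0 <= a -> 0 <= b -> 0 <= D ->
    mu * b ^+ 2 - K * (b * a) <= D -> m * b ^+ 2 <= c * a ^+ 2 + D.
Proof.
move=> mu0 c0 K0.
pose r := mu / (2 * K).
have r0 : 0 < r by rewrite divr_gt0// mulr_gt0.
have Kr : K * r = mu / 2 by rewrite /r; field; rewrite gt_eqF.
exists (Num.min (mu / 2) (c * r ^+ 2)).
  by rewrite lt_min divr_gt0//= mulr_gt0// exprn_gt0.
move=> a b D a0 b0 D0 HD.
have b20 : 0 <= b ^+ 2 by exact: sqr_ge0.
have [arb|/ltW arb] := leP a (r * b).
  apply: (@le_trans _ _ (mu / 2 * b ^+ 2)).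
    by rewrite ler_wpM2r// ge_min lexx.
  have : K * (b * a) <= mu / 2 * b ^+ 2.
    by rewrite -Kr -mulrA ler_pM2l// expr2 mulrCA ler_wpM2l.
  have := sqr_ge0 a; set a2 := a ^+ 2 => a20.
  by have : 0 <= c * a2 by [rewrite mulr_ge0// ltW]; move: HD; lra.
apply: (@le_trans _ _ (c * r ^+ 2 * b ^+ 2)).
  by rewrite ler_wpM2r// ge_min lexx orbT.
rewrite ler_wpDr// -mulrA ler_pM2l// -exprMn ler_sqr// nnegrE.
by rewrite mulr_ge0// ltW.
Qed.

End LocalBounds.

(** * Smoothness, convexity and curvature of [hhat] *)

Section Problem.
Context {R : realType} {n N : nat} (P : problem R n N).
Local Notation V := 'rV[R]_n.
Context (hN : (0 < N)%N) (hA1 : assumption1 P) (hA2 : assumption2 P)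
  (hgamma : stepsizes P).

Let df i x : differentiable (f_ P i) x.
Proof. by have [_ /(_ i)[[]]] := hA2. Qed.

Let dh i x : differentiable (h_ P i) x.
Proof. by have [_ /(_ i)[_ []]] := hA2. Qed.

Let ch i : convexR (h_ P i).
Proof. by have [/(_ i)[[/convexR_strict]]] := hA1. Qed.

Let chf i : convexR (L_ P i *: h_ P i - f_ P i).
Proof. by have [/(_ i)[_ [_ _ /convexR_convex_function]]] := hA1. Qed.

Lemma stepsize_gap i : 0 < (gamma_ P i)^-1 - N%:R^-1 * L_ P i.
Proof.
have [g0 gL] := hgamma i; have [/(_ i)[_ [L0 _ _]] _ _] := hA1.
have N0 : 0 < N%:R :> R by rewrite ltr0n.
have [->|Ln0] := eqVneq (L_ P i) 0; first by rewrite mulr0 subr0 invr_gt0.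
have Lp : 0 < L_ P i by rewrite lt_def Ln0.
rewrite subr_gt0 mulrC -[ltLHS]invrK ltf_pV2 ?posrE ?invr_gt0 ?divr_gt0//.
by rewrite invf_div gL.
Qed.

Lemma hhat_E i :
  hhat_ P i = (gamma_ P i)^-1 *: h_ P i - N%:R^-1 *: f_ P i.
Proof. by []. Qed.

(** Relative smoothness makes the second summand convex and [stepsize_gap] makes the first weight
    positive, so the convexity and curvature of [h_] pass to [hhat_]. *)
Lemma hhat_split i : hhat_ P i =
  ((gamma_ P i)^-1 - N%:R^-1 * L_ P i) *: h_ P i
  + N%:R^-1 *: (L_ P i *: h_ P i - f_ P i).
Proof.
by apply/funext => x; rewrite hhat_E !fctE /GRing.scale/=; ring.
Qed.

Lemma hhatE : hhat P = \sum_(i < N) hhat_ P i.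
Proof. by apply/funext => x; rewrite fct_sumE. Qed.

Lemma differentiable_hhat_ i x : differentiable (hhat_ P i) x.
Proof. by rewrite hhat_E; apply: differentiableB; apply: differentiableZ. Qed.

Lemma differentiable_hhat x : differentiable (hhat P) x.
Proof.
by rewrite hhatE; apply: differentiable_sum => i; exact: differentiable_hhat_.
Qed.

Lemma grad_hhat x : grad (hhat P) x = \sum_(i < N) grad (hhat_ P i) x.
Proof. by rewrite hhatE grad_sum// => i; exact: differentiable_hhat_. Qed.

Lemma convexR_hhat_ i : convexR (hhat_ P i).
Proof.
rewrite hhat_split; apply: convexRD; apply: convexRZ => //.
exact/ltW/stepsize_gap.
Qed.

Lemma convexR_hhat : convexR (hhat P).
Proof. by rewrite hhatE; apply: convexR_sum => i; exact: convexR_hhat_. Qed.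

Lemma differentiable_grad_hhat_ i x : differentiable (grad (hhat_ P i)) x.
Proof.
have -> : grad (hhat_ P i) =
    (gamma_ P i)^-1 *: grad (h_ P i) + (- N%:R^-1) *: grad (f_ P i).
  apply/funext => y; rewrite hhat_E -scaleNr gradD ?gradZ//.
  - exact: differentiableZ.
  - exact: differentiableZ.
have [_ /(_ i)[[_ dgf _] [_ dgh _] _]] := hA2.
by apply: differentiableD; apply: differentiableZ.
Qed.

Lemma calm_grad_hhat_ i x : calm (grad (hhat_ P i)) x.
Proof. exact/calm_diff/differentiable_grad_hhat_. Qed.

Lemma calm_grad_hhat x : calm (grad (hhat P)) x.
Proof.
apply: calm_diff.
have -> : grad (hhat P) = \sum_(i < N) grad (hhat_ P i).
  by apply/funext => y; rewrite grad_hhat fct_sumE.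
by apply: differentiable_sum => i; exact: differentiable_grad_hhat_.
Qed.

(** The other indices and the convex remainder in [hhat_split] contribute nonnegative distances. *)
Lemma bregman_hhat_ge i x y :
  ((gamma_ P i)^-1 - N%:R^-1 * L_ P i) * bregman (h_ P i) y x
  <= bregman (hhat P) y x.
Proof.
rewrite hhatE bregman_sum; last by move=> j; exact: differentiable_hhat_.
rewrite (bigD1 i)//= ler_wpDr//.
  apply: sumr_ge0 => j _; apply: bregman_ge0; first exact: convexR_hhat_.
  exact: differentiable_hhat_.
have dk : differentiable (L_ P i *: h_ P i - f_ P i) x.
  by apply: differentiableB => //; exact: differentiableZ.
rewrite hhat_split bregmanD ?bregmanZ//; do ?exact: differentiableZ.
by rewrite lerDl mulr_ge0 ?invr_ge0// bregman_ge0.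
Qed.

Lemma bregman_hhat_ge0 x y : 0 <= bregman (hhat P) y x.
Proof. exact: bregman_ge0 convexR_hhat (differentiable_hhat x). Qed.

Lemma bregman_hhat_lower x : exists mu d, [/\ 0 < mu, 0 < d &
  forall z, `|z - x| < d -> mu * `|z - x| ^+ 2 <= bregman (hhat P) x z].
Proof.
(* The curvature of a single kernel suffices, and [hN] provides an index. *)
pose i := Ordinal hN.
have [_ /(_ i)[_ [_ dgh _] pd]] := hA2.
have [mu [d [mu0 d0 muP]]] := bregman_lower (ch i) (dh i) (dgh x) (pd x).
exists (((gamma_ P i)^-1 - N%:R^-1 * L_ P i) * mu), d; split => //.
  by rewrite mulr_gt0// stepsize_gap.
move=> z /muP H; apply: le_trans (bregman_hhat_ge i z x).
by rewrite -mulrA ler_wpM2l// ltW// stepsize_gap.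
Qed.

(** * The mapping T: relation to [Lyap], fixed points, calmness *)

Lemma favgD_hhat w :
  favg P w + hhat P w = \sum_(i < N) (gamma_ P i)^-1 * h_ P i w.
Proof.
rewrite /favg /hhat mulr_sumr -big_split; apply: eq_bigr => i _ /=.
by rewrite /hhat_ addrC subrK.
Qed.

(** The first bracket is the objective minimized by T at grad hhat x, and the last term is constant
    in [w]; minimality in T thus becomes minimality of [Lyap] in its first argument. *)
Lemma LyapE x w : Lyap P w x =
  ((g_ P w + (\sum_(i < N) (gamma_ P i)^-1 * h_ P i w
              - dot (grad (hhat P) x) w)%:E)
   + (dot (grad (hhat P) x) x - hhat P x)%:E)%E.
Proof.
rewrite /Lyap /phi -favgD_hhat (addeC (favg P w)%:E) -!addeA -!EFinD.
by rewrite /bregman dotBr; congr (_ + _%:E)%E; ring.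
Qed.

Lemma Lyap_min x y w : Tmap P (grad (hhat P) x) y ->
  (Lyap P y x <= Lyap P w x)%E.
Proof. by move=> /(_ w) H; rewrite !LyapE leeD2r. Qed.

(** Near x the objective of T is at least its value at x, since phi is locally minimal there and the
    Bregman distance of [hhat] is nonnegative. The objective is convex, so the comparison extends
    along the segment from x to any w. *)
Lemma local_min_Tmap x : g_ P x \is a fin_num ->
  (\forall w \near x, (phi P x <= phi P w)%E) ->
  Tmap P (grad (hhat P) x) x.
Proof.
move=> gx /nbhs_ballP[d /= d0 dP] w.
set s := grad _ _.
have [cg _] := hA2; have [_ [[gNy _] _] _] := hA1.
have [->|gwy] := eqVneq (g_ P w) +oo%E.
  by rewrite addye ?leey// eqe.
have gw : g_ P w \is a fin_num by rewrite fin_numE gNy.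
pose r := `|w - x|; have r0 : 0 <= r by exact: normr_ge0.
have [t /andP[t0 t1] tr] := small_step r0 d0.
pose xt := t *: w + (1 - t) *: x.
have xtE : xt - x = t *: (w - x).
  by rewrite /xt scalerBl scale1r scalerBr addrCA addrAC subrr add0r.
have /dP : ball x d xt.
  by rewrite -ball_normE /ball_/= distrC xtE normrZ (gtr0_norm t0).
have := cg w x t; rewrite (ltW t0) (ltW t1) => /(_ isT); rewrite -/xt.
rewrite /phi -(fineK gw) -(fineK gx).
move: (fine _) (fine _) => b a gxt.
(* The convexity bound rules out +oo at [xt]; what remains is real arithmetic. *)
have gxtf : g_ P xt \is a fin_num.
  by rewrite fin_numE gNy/= lt_eqF// (le_lt_trans gxt)// -!EFinM -EFinD ltry.
move: gxt; rewrite -(fineK gxtf) /=; move: (fine _) => c.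
rewrite -!EFinM -!EFinD !lee_fin => gxt phixt.
have := bregman_hhat_ge0 x xt; rewrite /bregman -/s dotBr => Hb.
have cs : convexR (\sum_(i < N) (gamma_ P i)^-1 *: h_ P i).
  apply: convexR_sum => i; apply: convexRZ => //.
  by have [g0 _] := hgamma i; rewrite invr_ge0 ltW.
have sE y : (\sum_(i < N) (gamma_ P i)^-1 *: h_ P i) y =
    favg P y + hhat P y by rewrite favgD_hhat fct_sumE.
have := cs w x t; rewrite t0 t1 => /(_ isT).
rewrite !sE -/xt -!favgD_hhat => Hs.
have Hd : dot s xt = t * dot s w + (1 - t) * dot s x.
  by rewrite /xt dotDr !dotZr.
rewrite Hd in Hb.
rewrite -(ler_pM2l t0).
move: gxt phixt Hb Hs.
lra.
Qed.

(** Near grad hhat x the mapping is a function F, and [local_min_Tmap] identifies its value there as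
    x; calmness of F does the rest. *)
Lemma Tmap_calm x : g_ P x \is a fin_num ->
  (\forall w \near x, (phi P x <= phi P w)%E) ->
  set_strictly_differentiable (Tmap P) (grad (hhat P) x) ->
  exists C d, [/\ 0 < C, 0 < d & forall s, `|s - grad (hhat P) x| < d ->
    forall w, Tmap P s w -> `|w - x| <= C * `|s - grad (hhat P) x|].
Proof.
move=> gx hx [F [TF /strictly_differentiable_calm[C [d [C0 d0 dP]]]]].
have Fx : F (grad (hhat P) x) = x.
  have := local_min_Tmap gx hx.
  by rewrite (nbhs_singleton TF) => /esym.
move: TF => /nbhs_ballP[d' /= d'0 TF].
exists C, (Num.min d d'); split => //; first by rewrite lt_min d0.
move=> s; rewrite lt_min => /andP[sd sd'] w.
have -> : Tmap P s = [set F s].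
  by apply: TF; rewrite -ball_normE /ball_/= distrC.
move=> ->; by have := dP s sd; rewrite Fx.
Qed.

(** Induction on the number of passes: each adds two gradient differences, one at the new [zt] and
    one at [u], both linear in |u - x|. The constants are uniform over permutations and
    selections. *)
Lemma incremental_loop_calm x : g_ P x \is a fin_num ->
  (\forall w \near x, (phi P x <= phi P w)%E) ->
  set_strictly_differentiable (Tmap P) (grad (hhat P) x) ->
  exists C d, [/\ 0 < C, 0 < d & forall u s, `|u - x| < d ->
    incremental_loop P u s -> `|s - grad (hhat P) x| <= C * `|u - x|].
Proof.
move=> gx hx /(Tmap_calm gx hx)[CT [dT [CT0 dT0 TP]]].
(* One bound for all indices: the sum of the constants dominates each of them, and the minimum of
   finitely many radii is positive. *)
have [Cg [dg [Cg0 dg0 gP]]] : exists Cg dg, [/\ 0 < Cg, 0 < dg &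
    forall i y, `|y - x| < dg ->
      `|grad (hhat_ P i) y - grad (hhat_ P i) x| <= Cg * `|y - x|].
  pose good (i : 'I_N) C d := [/\ 0 < C, 0 < d & forall y, `|y - x| < d ->
      `|grad (hhat_ P i) y - grad (hhat_ P i) x| <= C * `|y - x|].
  have /(_ _)/cid-/all_sig[C /(_ _)/cid-/all_sig[d Cd]] :
    forall i, exists C d, good i C d by move=> i; exact: calm_grad_hhat_.
  exists (1 + \sum_i C i), (\big[Num.min/1]_i d i); split.
  - by rewrite ltr_pwDl// sumr_ge0// => i _; have [/ltW] := Cd i.
  - by apply: lt_bigmin => // i _; have [] := Cd i.
  - move=> i y yd; have [Ci di iP] := Cd i.
    apply: (le_trans (iP y _)).
      by apply: (lt_le_trans yd); exact: bigmin_le_cond.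
    rewrite ler_wpM2r// (bigD1 i)//= addrCA lerDl addr_ge0//.
    by rewrite sumr_ge0// => j _; have [/ltW] := Cd j.
suff loopP : forall m, (m <= N)%N -> exists C d, [/\ 0 < C, 0 < d &
    forall u (i : {perm 'I_N}) (zt : 'I_N -> V) (sl : nat -> V),
    `|u - x| < d -> sl 0%N = grad (hhat P) u ->
    (forall l : 'I_N, Tmap P (sl l) (zt (i l))) ->
    (forall l : 'I_N, sl l.+1 = sl l + grad (hhat_ P (i l)) (zt (i l))
        - grad (hhat_ P (i l)) u) ->
    `|sl m - grad (hhat P) x| <= C * `|u - x|].
  have [C [d [C0 d0 H]]] := loopP N (leqnn N).
  exists C, d; split => // u s ud [i [zt [sl [s0 hz hs ->]]]].
  exact: H hz hs.
elim=> [_|m IH mN].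
  have [C [d [C0 d0 H]]] := calm_grad_hhat x.
  by exists C, d; split => // u i zt sl ud -> _ _; exact: H.
have [C [d [C0 d0 H]]] := IH (ltnW mN).
(* The summands account for the deviation so far, the gradient at the new [zt] and the gradient at
   [u]. The last two radii keep [sl m] where T is calm and [zt] where the gradients are. *)
exists (C + Cg * (CT * C) + Cg), (Num.min (Num.min d dg)
  (Num.min (dT / C) (dg / (CT * C)))).
split; first by rewrite !addr_gt0// !mulr_gt0//.
  by rewrite !lt_min d0 dg0 !divr_gt0 ?mulr_gt0.
move=> u i zt sl; rewrite !lt_min.
move=> /andP[/andP[ud udg] /andP[udT udg']] s0 hz hs.
have Hm := H u i zt sl ud s0 hz hs.
rewrite ltr_pdivlMr// mulrC in udT.
rewrite ltr_pdivlMr ?mulr_gt0// mulrC in udg'.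
pose l := Ordinal mN.
have Hz : `|zt (i l) - x| <= CT * C * `|u - x|.
  apply: (le_trans (TP _ _ _ (hz l))); first exact: le_lt_trans Hm udT.
  by rewrite -mulrA ler_wpM2l// ltW.
have Hgz := gP (i l) _ (le_lt_trans Hz udg').
have Hgu := gP (i l) _ udg.
have -> : sl m.+1 - grad (hhat P) x = (sl m - grad (hhat P) x)
    + (grad (hhat_ P (i l)) (zt (i l)) - grad (hhat_ P (i l)) x)
    - (grad (hhat_ P (i l)) u - grad (hhat_ P (i l)) x).
  rewrite (hs l)/=.
  move: (grad _ (zt _)) (grad _ u) (grad (hhat_ P _) x) (grad _ x) => a b c e.
  by apply/rowP => j; rewrite !mxE; ring.
rewrite !mulrDl; apply: (le_trans (ler_normB _ _)); apply: lerD => //.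
apply: (le_trans (ler_normD _ _)); apply: lerD => //.
by apply: (le_trans Hgz); rewrite -mulrA ler_wpM2l// ltW.
Qed.

(** * The linesearch test near the limit point *)

Lemma Tmap_fin_num s w : Tmap P s w -> g_ P w \is a fin_num.
Proof.
have [_ [[gNy [x gx]] _] _] := hA1.
move=> /(_ x); rewrite fin_numE gNy/=; apply: contraTneq => ->.
by rewrite addye// leye_eq; case: (g_ P x) (gNy x) gx.
Qed.

Lemma Lyap_decrease x : g_ P x \is a fin_num -> strong_local_min (phi P) x ->
  set_strictly_differentiable (Tmap P) (grad (hhat P) x) ->
  exists e d, [/\ 0 < e, 0 < d & forall z u v y,
    `|z - x| < d -> `|u - x| <= e * `|z - x| ->
    Tmap P (grad (hhat P) z) v -> Tmap P (grad (hhat P) u) y ->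
    (Lyap P y u <= Lyap P v z)%E].
Proof.
move=> gx sx hT; have wx := strong_local_min_le sx.
have [CT [dT [CT0 dT0 TP]]] := Tmap_calm gx wx hT.
have [c c0 /nbhs_ballP[dc /= dc0 cP]] := sx.
have [mu [dmu [mu0 dmu0 muP]]] := bregman_hhat_lower x.
have [K [dK [K0 dK0 KP]]] :=
  bregman_upper convexR_hhat differentiable_hhat (calm_grad_hhat x).
have [Cg [dg [Cg0 dg0 gP]]] := calm_grad_hhat x.
have K'0 : 0 < n%:R * Cg + 1 by rewrite ltr_wpDl// mulr_ge0// ltW.
have c20 : 0 < c / 2 by rewrite divr_gt0.
have [m m0 mP] := quadratic_growth mu0 c20 K'0.
(* The bound 1 keeps [u] as close to x as [z], and [m / K] turns the upper estimate at [u] into m |z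
   - x|^2. The radii [dT / Cg] and [dc / (CT * Cg)] put grad hhat z where T is calm and [v] where
   phi grows quadratically. *)
exists (Num.min 1 (m / K)), (Num.min (Num.min dmu dK)
  (Num.min dg (Num.min (dT / Cg) (dc / (CT * Cg))))).
split; first by rewrite lt_min ltr01 divr_gt0.
  by rewrite !lt_min dmu0 dK0 dg0 !divr_gt0 ?mulr_gt0.
move=> z u v y; rewrite !lt_min => /andP[/andP[zmu zK]].
move=> /and3P[zg zT zc] uz Tv Ty.
rewrite ltr_pdivlMr// mulrC in zT.
rewrite ltr_pdivlMr ?mulr_gt0// mulrC in zc.
set b := `|z - x| in zmu zK zg zT zc uz *.
have b0 : 0 <= b by exact: normr_ge0.
have gz : `|grad (hhat P) z - grad (hhat P) x| <= Cg * b by exact: gP.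
have vx : `|v - x| <= CT * Cg * b.
  apply: (le_trans (TP _ _ _ Tv)); first exact: le_lt_trans gz zT.
  by rewrite -mulrA ler_wpM2l// ltW.
have ub : `|u - x| <= b.
  by apply: (le_trans uz); rewrite ler_piMl// ge_min lexx.
have DU : bregman (hhat P) x u <= m * b ^+ 2.
  apply: (le_trans (KP u (le_lt_trans ub zK))).
  apply: (@le_trans _ _ (K * (Num.min 1 (m / K) * b ^+ 2))).
    by rewrite ler_pM2l// !expr2 mulrA ler_pM.
  rewrite mulrA ler_wpM2r ?sqr_ge0// mulrC -ler_pdivlMr//.
  by rewrite ge_min lexx orbT.
(* Three-point identity through x: the distance from x to [v] is dropped as nonnegative, and
   calmness of the gradient bounds the cross term. *)
have DL : mu * b ^+ 2 - (n%:R * Cg + 1) * (b * `|v - x|)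
    <= bregman (hhat P) v z.
  rewrite (bregman_three_points _ _ x) -addrA lerD//; first exact: muP.
  rewrite -[leLHS]add0r lerD ?bregman_hhat_ge0//.
  rewrite lerNl; apply: (le_trans (ler_norm _)); rewrite normrN.
  apply: (le_trans (norm_dot_le _ _)).
  rewrite (distrC (grad _ x)) mulrDl mul1r ler_wpDr ?mulr_ge0//.
  by rewrite -!mulrA ler_wpM2l// mulrA ler_wpM2r.
have := mP _ _ _ (normr_ge0 (v - x)) b0 (bregman_hhat_ge0 z v) DL => HM.
(* Minimality of [y] allows replacing it by x, so only phi x + D(x, u) has to be bounded. *)
apply: (le_trans (Lyap_min x Ty)); rewrite /Lyap.
have vc : `|v - x| < dc by exact: le_lt_trans vx zc.
have /cP Hv : ball x dc v by rewrite -ball_normE /ball_/= distrC.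
apply: le_trans (leeD2r _ Hv).
rewrite -[leRHS](addeA (phi P x)) -EFinD leeD2l// lee_fin.
apply: (le_trans DU); apply: (le_trans HM); rewrite lerD2r.
by rewrite ler_pM2l// ler_sqr ?nnegrE ?sqrtr_ge0// enorm_ge.
Qed.

(** The hypothesis ranges over every selection [y] the loop could make; the other two constructors
    record a failed test and so contradict it. *)
Lemma linesearch_first beta qmax (z v d : V) r :
  (forall y, Tmap P (grad (hhat P) (z + d)) y ->
    (Lyap P y (z + d) <= Lyap P v z)%E) ->
  linesearch P beta qmax z v d 1 0 r -> r = LsResult (z + d) 1 0 true.
Proof.
move=> H.
have E : 1 *: z + (1 - 1) *: v + 1 *: d = z + d.
  by rewrite !scale1r subrr scale0r addr0.
move=> L; inversion L as [t q u y Ty Ly|t q u y Ty Ly|t q u y r' Ty Ly];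
  rewrite /u E in Ty Ly *; by [|case: Ly; exact: H].
Qed.

End Problem.

(** * Eventual acceptance of unit steps and the superlinear rate *)

Theorem theorem4p12 (R : realType) (n N : nat) (hN : (0 < N)%N)
    (P : problem R n N)
    (hA1 : assumption1 P) (hA2 : assumption2 P) (hgamma : stepsizes P)
    (zinit : 'rV[R]_n) (beta : R) (hbeta : 0 < beta < 1) (qmax : option nat)
    (s z v d : nat -> 'rV[R]_n) (ls : nat -> ls_result)
    (hrun : spiral P zinit beta qmax s z v d ls)
    (zs : 'rV[R]_n)
    (hcvg : z @ \oo --> zs) (hmin : strong_local_min (phi P) zs)
    (hdir : superlinear_directions z d zs)
    (hT : set_strictly_differentiable (Tmap P) (grad (hhat P) zs)) :
  (\forall k \near \oo,
     [/\ ls_accepted (ls k), ls_tau (ls k) = 1 & ls_q (ls k) = 0%N]) /\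
  superlinear_cvg z zs.
Proof.
have [_ run] := hrun.
have wmin := strong_local_min_le hmin.
have zdist e : 0 < e -> \forall k \near \oo, `|z k - zs| < e.
  by move=> e0; have /cvgrPdistC_lt := hcvg; exact.
(* Some iterate lies in the neighborhood of local minimality. Being a minimizer from T, it has
   finite g, which forces phi to be finite at [zs]. *)
have gzs : g_ P zs \is a fin_num.
  have [k] : exists k, (phi P zs <= phi P (z k))%E.
    by have [k _ /(_ k (leqnn k))] := hcvg _ wmin; exists k.
  have [/(Tmap_fin_num hA1)/fineK gk _ _ _] := run k.
  have [_ [[gNy _] _] _] := hA1.
  rewrite /phi -gk fin_numE gNy/=; apply: contraTneq => ->.
  by rewrite addey// -EFinD.
have [e [dL [e0 dL0 Lyap_le]]] := Lyap_decrease hN hA1 hA2 hgamma gzs hmin hT.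
have [CT [dT [CT0 dT0 TP]]] := Tmap_calm hN hA1 hA2 hgamma gzs wmin hT.
have [CI [dI [CI0 dI0 loopP]]] :=
  incremental_loop_calm hN hA1 hA2 hgamma gzs wmin hT.
have first_try : \forall k \near \oo, ls k = LsResult (z k + d k) 1 0 true.
  near=> k; have [_ Tv L _] := run k.
  apply: linesearch_first L => y Ty.
  apply: (Lyap_le (z k)) Tv Ty; first by near: k; exact: zdist.
  by near: k; exact: superlinear_directions_le hdir e0.
split; first by apply: filterS first_try => k ->.
(* One outer iteration is the loop followed by T, so the calmness constants multiply; directions
   accurate to [c / (CT * CI)] compensate for them. *)
have contract c : 0 < c ->
    \forall k \near \oo, `|z k.+1 - zs| <= c * `|z k - zs|.
  move=> c0; near=> k.
  have [_ _ _] := run k; rewrite (near first_try k)//= => loop.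
  have [Tz _ _ _] := run k.+1.
  have u1 : `|z k + d k - zs| <= 1 * `|z k - zs|.
    by near: k; exact: superlinear_directions_le hdir ltr01.
  rewrite mul1r in u1.
  have uc : `|z k + d k - zs| <= c / (CT * CI) * `|z k - zs|.
    near: k; apply: superlinear_directions_le hdir _.
    by rewrite divr_gt0 ?mulr_gt0.
  have zI : `|z k - zs| < dI by near: k; exact: zdist.
  have zT : `|z k - zs| < dT / CI.
    by near: k; apply: zdist; rewrite divr_gt0.
  have sP := loopP _ _ (le_lt_trans u1 zI) loop.
  apply: (le_trans (TP _ _ _ Tz)).
    apply: (le_lt_trans sP); rewrite mulrC -ltr_pdivlMr//.
    exact: le_lt_trans u1 zT.
  apply: (@le_trans _ _ (CT * (CI * `|z k + d k - zs|))).
    by rewrite ler_pM2l.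
  by rewrite mulrA mulrC -ler_pdivlMr ?mulr_gt0// mulrAC.
(* Outside the finite-termination case every quotient has a positive denominator. *)
have [zk|zk] := pselect (exists k, z k = zs); first by left.
right; apply/cvgrPdist_le => c c0.
(* The factor [n.+1] pays for the return from the sup norm to the Euclidean norm. *)
have c'0 : 0 < c / n.+1%:R by rewrite divr_gt0.
near=> k.
have p0 : 0 < enorm (z k - zs).
  rewrite lt_def enorm_eq0 subr_eq0 sqrtr_ge0 andbT.
  by apply/eqP => E; apply: zk; exists k.
rewrite sub0r normrN ger0_norm ?divr_ge0 ?sqrtr_ge0// ler_pdivrMr//.
apply: (le_trans (enorm_le _)).
rewrite mulrC -ler_pdivlMr// mulrAC.
have : `|z k.+1 - zs| <= c / n.+1%:R * `|z k - zs|.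
  by near: k; exact: contract.
by move=> /le_trans; apply; rewrite ler_pM2l// enorm_ge.
Unshelve. all: by end_near. Qed.
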